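(* Let $T\in(0,\infty)$ and let $(E,d)$ be a metric space. If $\delta\in(0,1)$ and $p\in(1,\infty)$ are such that $\delta>1/p$, then one has the inclusions $$W^{\delta,p}([0,T];E)\subset V^{\delta,p}([0,T];E)\subset N^{\delta,p}([0,T];E)$$ and $$N^{\delta+\epsilon,p}([0,T];E)\subset\hat N^{\delta,p}([0,T];E)\subset N^{\delta,p}([0,T];E)$$ for $\epsilon\in(0,1-\delta)$.
   Context: $\mathcal{P}\subset[s,t]$ means $\mathcal{P}=\{[t_i,t_{i+1}]: s=t_0<t_1<\dots<t_M=t\}$ is a finite partition of $[s,t]$. For a continuous $f:[0,T]\to E$ and $[s,t]\subset[0,T]$: $\|f\|_{W^{\delta,p};[s,t]}=\Big(\iint_{[s,t]^2}\frac{d(f_u,f_v)^p}{|v-u|^{1+\delta p}}\,du\,dv\Big)^{1/p}$, $\|f\|_{V^{\delta,p};[s,t]}=\big(\sup_{\mathcal{P}\subset[s,t]}\sum_{[u,v]\in\mathcal{P}}\frac{d(f_u,f_v)^p}{|v-u|^{\delta p-1}}\big)^{1/p}$, $\|f\|_{N^{\delta,p};[s,t]}=\sup_{0<h\le t-s}h^{-\delta}\big(\int_s^{t-h}d(f_u,f_{u+h})^p\,du\big)^{1/p}$, $\|f\|_{\hat N^{\delta,p};[s,t]}=\big(\sup_{\mathcal{P}\subset[s,t]}\sum_{[u,v]\in\mathcal{P}}\|f\|_{N^{\delta,p};[u,v]}^p\big)^{1/p}$. $W^{\delta,p}$, $V^{\delta,p}$, $N^{\delta,p}$, $\hat N^{\delta,p}$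 (each followed by $([0,T];E)$) are the sets of continuous $f:[0,T]\to E$ for which the corresponding quantity on $[0,T]$ is finite. *)

(* Defs.v *)
From HB Require Import structures.
From mathcomp Require Import all_boot all_order all_algebra.
From mathcomp Require Import all_classical all_reals all_analysis.

Set Implicit Arguments.
Unset Strict Implicit.
Unset Printing Implicit Defensive.

Import Order.TTheory GRing.Theory Num.Theory.
Import numFieldNormedType.Exports.

Local Open Scope classical_set_scope.
Local Open Scope ring_scope.

(* A path f : [0,T] -> E is represented by f : R -> E; every definition below
   depends only on the restriction of f to [s,t] (resp. [0,T]).
   All (semi)norms take values in \bar R, with +oo when the defining quantity
   is infinite. *)

(* \sum_([u,v] in P) F u v, for the partition P of [s,t] whose points are
   s :: l, where [itv_partition s t l] states that s :: l is strictly
   increasing with last element t. *)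
Definition partition_sum (R : realType) (F : R -> R -> \bar R) (s : R)
    (l : seq R) : \bar R :=
  (\sum_(0 <= i < size l) F (nth s (s :: l) i) (nth s (s :: l) i.+1))%E.

Definition partition_sup (R : realType) (F : R -> R -> \bar R) (s t : R) :
    \bar R :=
  ereal_sup [set partition_sum F s l | l in itv_partition s t].

(* On the diagonal u = v, a null set, the integrand is 0 / 0 = 0. *)
Definition Wnorm (R : realType) (E : metricType R) (delta p : R) (f : R -> E)
    (s t : R) : \bar R :=
  ((\int[lebesgue_measure \x lebesgue_measure]_(z in `[s, t] `*` `[s, t])
     (mdist (f z.1) (f z.2) `^ p / `|z.2 - z.1| `^ (1 + delta * p))%:E)
   `^ p^-1)%E.

Definition Vnorm (R : realType) (E : metricType R) (delta p : R) (f : R -> E)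
    (s t : R) : \bar R :=
  (partition_sup
    (fun u v => (mdist (f u) (f v) `^ p / `|v - u| `^ (delta * p - 1))%:E)
    s t `^ p^-1)%E.

Definition Nnorm (R : realType) (E : metricType R) (delta p : R) (f : R -> E)
    (s t : R) : \bar R :=
  ereal_sup
    [set ((h `^ (- delta))%:E *
          (\int[lebesgue_measure]_(u in `[s, (t - h)%R])
             (mdist (f u) (f (u + h)) `^ p)%:E) `^ p^-1)%E
    | h in `]0, (t - s)%R]].

Definition Nhatnorm (R : realType) (E : metricType R) (delta p : R)
    (f : R -> E) (s t : R) : \bar R :=
  (partition_sup (fun u v => Nnorm delta p f u v `^ p) s t `^ p^-1)%E.

Definition Wspace (R : realType) (E : metricType R) (T delta p : R) :
    set (R -> E) :=
  [set f | {within `[0, T], continuous f} /\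
           (Wnorm delta p f 0%R T < +oo)%E].

Definition Vspace (R : realType) (E : metricType R) (T delta p : R) :
    set (R -> E) :=
  [set f | {within `[0, T], continuous f} /\
           (Vnorm delta p f 0%R T < +oo)%E].

Definition Nspace (R : realType) (E : metricType R) (T delta p : R) :
    set (R -> E) :=
  [set f | {within `[0, T], continuous f} /\
           (Nnorm delta p f 0%R T < +oo)%E].

Definition Nhatspace (R : realType) (E : metricType R) (T delta p : R) :
    set (R -> E) :=
  [set f | {within `[0, T], continuous f} /\
           (Nhatnorm delta p f 0%R T < +oo)%E].

Arguments Wspace {R} E T delta p _.
Arguments Vspace {R} E T delta p _.
Arguments Nspace {R} E T delta p _.
Arguments Nhatspace {R} E T delta p _.

(* Main.v *)
Require Import Defs.
From mathcomp Require Import all_boot all_order all_algebra.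
From mathcomp Require Import all_classical all_reals all_analysis.
From mathcomp Require Import measurable_realfun ring lra.

Set Implicit Arguments.
Unset Strict Implicit.
Unset Printing Implicit Defensive.

Import Order.TTheory GRing.Theory Num.Theory.
Import numFieldNormedType.Exports.

Local Open Scope classical_set_scope.
Local Open Scope ring_scope.

(** For a path f and an exponent p, say that f is controlled by w on [0, T] when
    w is nonnegative and superadditive on adjacent intervals and
      d(f u, f v)^p <= (v - u)^(delta p - 1) w(u, v)   for u < v.
    Except for the inclusion of N^ in N, seen by taking the partition into a
    single interval, each inclusion follows from a control with w(0, T) finite.

    - V: superadditivity bounds the sum of w over a partition by w(0, T)
      ([Vnorm_lty_of_controlled]).
    - N: cut the domain of u |-> d(f u, f (u + h))^p into blocks of length h and
      translate them onto the first one.  The integrand becomes the sum of the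
      p-th powers of the increments along x, x + h, x + 2h, and so on, which is
      at most h^(delta p - 1) w(0, T); integrating over a block gives
      h^(delta p) w(0, T) ([increment_integral_le_control]).
    - N^: the same estimate on each [u, v] gives N(u, v)^p <= w(u, v), and these
      values sum to at most w(0, T) ([Nhatnorm_lty_of_controlled]).

    If f has finite V norm, the supremum over partitions of [u, v] that defines
    this norm is itself a control, because partitions concatenate
    ([control_partition_sup]).

    For W and for N at regularity delta + eps, the control comes from the energy
      e(a, b) = sum_n h_n^(- delta p) int_[a, b - h_n] d(f x, f (x + h_n))^p dx
    with h_n = tau / 2^n, which is superadditive term by term.  The core of the
    proof is that e(a, b) + (b - a) controls f up to a constant
    ([controlled_dyadic_energy]).  The mean of d(f a, f x) over x in
    [a, a + 2h] exceeds the mean over [a, a + h] by at most half the mean of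
    d(f x, f (x + h)) over [a, a + h], since translation by h carries the second
    half onto the first.  The n-th such error is of order
    e^(1/p) h_n^(delta - 1/p), so that, as delta > 1/p, the errors sum
    geometrically down to scale 0, where the mean vanishes by continuity
    ([dyadic_recursion_bound], [dist_le_of_increment_integral]).  The same bound
    holds from the endpoint b, and the triangle inequality through x, averaged
    over x in [a, b], joins the two.

    It remains to see that e(0, T) is finite for some tau in [T / 2, T].  A
    finite N norm at regularity delta + eps bounds the n-th term by a multiple
    of h_n^(eps p), which is summable ([dyadic_energy_lty_of_Nnorm]).  A finite
    W norm gives, by Tonelli in the variables (x, h = y - x) and by rescaling
    each dyadic range of h to ]T / 2, T], that the energy at tau, divided by
    tau, has finite integral over tau in ]T / 2, T]; hence the energy is finite
    for some tau ([dyadic_energy_lty_of_Wnorm]). *)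

(** * Affine changes of variable in the Lebesgue integral *)

Lemma preimage_affine_itv (R : realType) (c d a b : R) (x y : bool) : 0 < c ->
  (fun t : R => c * t + d) @^-1`
    [set` Interval (BSide x (c * a + d)) (BSide y (c * b + d))] =
  [set` Interval (BSide x a) (BSide y b)].
Proof.
move=> c0; apply/seteqP; split=> t /=; rewrite !in_itv/=;
  by case: x; case: y => /=; rewrite ?lerD2r ?ltrD2r ?ler_pM2l ?ltr_pM2l.
Qed.

Lemma measurable_affine (R : realType) (c d : R) :
  measurable_fun [set: R] (fun t : R => c * t + d).
Proof. by apply: measurable_funD => //; apply: measurable_funM. Qed.

(** Lebesgue measure is determined by its values on half-open intervals, whose
    preimages under t |-> c t + d are again half-open intervals. *)
Lemma lebesgue_measure_affine (R : realType) (c d : R) (c0 : 0 < c)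
    (A : set R) : measurable A ->
  @lebesgue_measure R A = (c%:E *
    pushforward (@lebesgue_measure R)
      (fun t : R => (c * t + d)%R : measurableTypeR R) A)%E.
Proof.
move=> mA.
pose phi : measurableTypeR R -> measurableTypeR R := fun t : R => (c * t + d)%R.
have mphi : measurable_fun [set: measurableTypeR R] phi.
  exact: measurable_affine.
pose nu := mscale (NngNum (ltW c0)) (pushforward (@lebesgue_measure R) phi).
suff nuE X : ocitv X -> lebesgue_measure X = nu mphi X.
  exact: (lebesgue_measure_unique nuE).
move=> [[a b]] _ <-.
rewrite /nu /mscale/= /pushforward/=.
have -> : phi @^-1` `]a, b] = `](a - d) / c, (b - d) / c]%classic.
  have cK z : c * ((z - d) / c) + d = z.
    by rewrite mulrC divfK ?lt0r_neq0// subrK.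
  by rewrite -[RHS](preimage_affine_itv d _ _ _ _ c0) !cK.
rewrite !lebesgue_measure_itv/= !lte_fin ltr_pM2r ?invr_gt0// ltrD2r.
case: ifPn => _; last by rewrite mule0.
rewrite -!EFinB -EFinM; congr EFin; field.
exact: lt0r_neq0.
Qed.

Lemma ge0_integral_affine (R : realType) (c d : R) (D : set R)
    (f : R -> \bar R) : 0 < c -> measurable D ->
  measurable_fun D f -> (forall x, D x -> 0 <= f x)%E ->
  (\int[lebesgue_measure]_(x in D) f x =
   c%:E * \int[lebesgue_measure]_(x in (fun t : R => c * t + d)%R @^-1` D)
     f (c * x + d)%R)%E.
Proof.
move=> c0 mD mf f0.
pose phi : measurableTypeR R -> measurableTypeR R := fun t : R => (c * t + d)%R.
have mphi : measurable_fun [set: measurableTypeR R] phi.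
  exact: measurable_affine.
rewrite (eq_measure_integral
  (mscale (NngNum (ltW c0)) (pushforward (@lebesgue_measure R) phi)));
  last by move=> A mA _; exact: lebesgue_measure_affine.
rewrite ge0_integral_mscale//; congr (_ * _)%E.
rewrite ge0_integral_pushforward// => x /[!inE]; exact: f0.
Qed.

Lemma ge0_integral_shift_itv (R : realType) (d a b : R) (f : R -> \bar R) :
  measurable_fun `[a + d, b + d] f ->
  (forall x, 0 <= f x)%E ->
  (\int[lebesgue_measure]_(x in `[(a + d)%R, (b + d)%R]) f x =
   \int[lebesgue_measure]_(x in `[a, b]) f (x + d)%R)%E.
Proof.
move=> mf f0; rewrite (@ge0_integral_affine R 1 d)//.
rewrite mul1e -{1}[a]mul1r -{1}[b]mul1r preimage_affine_itv//.
by apply: eq_integral => x _; rewrite mul1r.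
Qed.

Lemma ge0_integral_shiftT (R : realType) (d : R) (f : R -> \bar R) :
  measurable_fun [set: R] f -> (forall x, 0 <= f x)%E ->
  (\int[lebesgue_measure]_x f x = \int[lebesgue_measure]_x f (x + d)%R)%E.
Proof.
move=> mf f0; rewrite (@ge0_integral_affine R 1 d)//.
rewrite mul1e preimage_setT.
by apply: eq_integral => x _; rewrite mul1r.
Qed.

Lemma ge0_integral_itv_split (R : realType) (F : R -> \bar R) (a b c : R) :
  measurable_fun [set: R] F -> (forall x, 0 <= F x)%E -> a <= b -> b <= c ->
  (\int[lebesgue_measure]_(x in `[a, c]) F x =
   \int[lebesgue_measure]_(x in `[a, b]) F x +
   \int[lebesgue_measure]_(x in `[b, c]) F x)%E.
Proof.
move=> mF F0 ab bc.
rewrite (@itv_bndbnd_setU _ _ _ (BRight b))// ?bnd_simp//.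
rewrite ge0_integral_setU//=; last 2 first.
- exact: measurable_funTS.
- rewrite disj_set2E; apply/eqP/seteqP; split => // x [] /=.
  by rewrite !in_itv/= => /andP[_ ?] /andP[? _]; lra.
by congr (_ + _)%E; rewrite integral_itv_obnd_cbnd//; exact: measurable_funTS.
Qed.

Lemma ge0_itv_integral_le (R : realType) (F : R -> \bar R) (a b a' b' : R) :
  measurable_fun [set: R] F -> (forall x, 0 <= F x)%E -> a' <= a -> b <= b' ->
  (\int[lebesgue_measure]_(x in `[a, b]) F x <=
   \int[lebesgue_measure]_(x in `[a', b']) F x)%E.
Proof.
move=> mF F0 aa bb; apply: ge0_subset_integral => //.
  exact: measurable_funTS.
by move=> x /=; rewrite !in_itv/= => /andP[? ?]; apply/andP; split; lra.
Qed.

(** * Distances between points of a continuous path *)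

Lemma ler_dist_mdist (R : realType) (E : metricType R) (c x y : E) :
  `|mdist c x - mdist c y| <= mdist x y.
Proof.
have := metric_triangle c x y; have := metric_triangle c y x.
by rewrite [mdist y x]metric_sym ler_norml => *; apply/andP; split; lra.
Qed.

Lemma continuous_mdist (R : realType) (E : metricType R) (f : R -> E) (c : E) :
  continuous f -> continuous (fun x => mdist c (f x)).
Proof.
move=> cf x; apply/cvgrPdist_lt => /= e e0.
have fx := metricType_numDomainType.cvgr_dist_lt (cf x) e0.
near=> y; rewrite (le_lt_trans (ler_dist_mdist _ _ _))//.
by near: y; exact: fx.
Unshelve. all: by end_near.
Qed.

(** By density of the f q, with q rational, in the range of f, d(f x, f y) is
    the infimum over q of d(f q, f x) + d(f q, f y): a countable infimum of sums
    of functions of one variable, hence measurable for the product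
    sigma-algebra. *)
Lemma measurable_mdist (R : realType) (E : metricType R) (f : R -> E) :
  continuous f ->
  measurable_fun [set: R * R] (fun z => mdist (f z.1) (f z.2)).
Proof.
move=> cf; apply: (measurability _ (RGenInftyO.measurableE R)) => //.
move=> _ [_ [a ->] <-]; rewrite setTI preimage_itvNyo.
rewrite [X in measurable X](_ : _ = \bigcup_(q : rat)
   [set z : R * R |
     mdist (f (ratr q)) (f z.1) + mdist (f (ratr q)) (f z.2) < a]).
  apply: bigcupT_measurable_rat => q.
  have mq : measurable_fun [set: R] (fun x => mdist (f (ratr q)) (f x)).
    by apply: continuous_measurable_fun; exact: continuous_mdist.
  rewrite -preimage_itvNyo -[X in measurable X]setTI.
  apply: (@measurable_funD _ _ _ _ (fun z : R * R => mdist (f (ratr q)) (f z.1))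
    (fun z : R * R => mdist (f (ratr q)) (f z.2))) => //.
    exact: (measurableT_comp mq measurable_fst).
  exact: (measurableT_comp mq measurable_snd).
apply/seteqP; split=> [[x y] /= xya|[x y] [q _] /=]; last first.
  apply: le_lt_trans; rewrite [X in _ <= X + _]metric_sym.
  exact: metric_triangle.
(* Passing through f q adds at most 2 d(f q, f x) to d(f x, f y). *)
have e0 : 0 < (a - mdist (f x) (f y)) / 2 by rewrite divr_gt0// subr_gt0.
have [/= r r0 xr] := metricType_numDomainType.cvgr_dist_lt (cf x) e0.
have [q] : exists q : rat, ratr q \in `]x - r, x + r[.
  by apply: rat_in_itvoo; rewrite ltrBlDr -addrA ltrDl addr_gt0.
rewrite in_itv/= => /andP[xq qx].
have xqd : mdist (f x) (f (ratr q)) < (a - mdist (f x) (f y)) / 2.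
  by apply: xr; rewrite /= ltr_distlC xq.
exists q => //=; rewrite metric_sym.
have := metric_triangle (f (ratr q)) (f x) (f y).
rewrite [mdist (f (ratr q)) (f x)]metric_sym; lra.
Qed.

(** * Superadditive controls and sums over partitions *)

Lemma partition_sum_cons (R : realType) (F : R -> R -> \bar R) (s a : R)
    (l : seq R) :
  partition_sum F s (a :: l) = (F s a + partition_sum F a l)%E.
Proof.
rewrite /partition_sum /= big_nat_recl//=; congr (_ + _)%E.
apply: eq_big_nat => i /= il; congr F; apply: set_nth_default => //=.
exact: ltnW.
Qed.

(** Superadditivity over adjacent intervals is what makes the sum of w over a
    partition of [s, t] collapse to w s t. *)
Record control (R : realType) (w : R -> R -> \bar R) (s t : R) : Prop := {
  control_ge0 : forall a b, s <= a -> a <= b -> b <= t -> (0 <= w a b)%E ;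
  control_superadditive : forall a b c, s <= a -> a <= b -> b <= c -> c <= t ->
    (w a b + w b c <= w a c)%E }.

Lemma controlS (R : realType) (w : R -> R -> \bar R) (s t s' t' : R) :
  control w s t -> s <= s' -> t' <= t -> control w s' t'.
Proof.
move=> [w0 wD] ss' tt'; split => [a b sa ab bt|a b c sa ab bc ct].
  by apply: w0 => //; [exact: le_trans sa|exact: le_trans tt'].
by apply: wD => //; [exact: le_trans sa|exact: le_trans tt'].
Qed.

Lemma control_le (R : realType) (w : R -> R -> \bar R) (s t a b c d : R) :
  control w s t -> s <= a -> a <= b -> b <= c -> c <= d -> d <= t ->
  (w b c <= w a d)%E.
Proof.
move=> [w0 wD] sa ab bc cd dt.
have bt : b <= t by rewrite (le_trans bc)// (le_trans cd).
have sc : s <= c by rewrite (le_trans sa)// (le_trans ab).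
have -> : (w b c = 0 + (w b c + 0))%E by rewrite adde0 add0e.
apply: le_trans (wD a b d _ _ _ _) => //; last exact: le_trans cd.
rewrite leeD// ?w0//; apply: le_trans (wD b c d _ _ _ _) => //.
  by rewrite leeD// w0.
exact: le_trans ab.
Qed.

Lemma partition_sum_le_control (R : realType) (F w : R -> R -> \bar R)
    (s t : R) (l : seq R) : control w s t ->
  (forall u v, s <= u -> u < v -> v <= t -> (F u v <= w u v)%E) ->
  itv_partition s t l -> (partition_sum F s l <= w s t)%E.
Proof.
elim: l s => [|a l ih] s wc Fw lst.
  rewrite -(itv_partition_nil lst) /partition_sum big_nil.
  by rewrite (control_ge0 wc)// (itv_partition_nil lst).
have sa : s < a by case: lst => /= /andP[].
have lat := itv_partition_cons lst; have a_le_t := itv_partition_le lat.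
rewrite partition_sum_cons.
apply: le_trans (control_superadditive wc _ (ltW sa) a_le_t _) => //.
rewrite leeD ?Fw// ih//.
  exact: (controlS wc (ltW sa) (lexx t)).
by move=> u v au; apply: Fw; apply: le_trans au; exact: ltW.
Qed.

Lemma partition_sup_le_control (R : realType) (F w : R -> R -> \bar R)
    (s t : R) : control w s t ->
  (forall u v, s <= u -> u < v -> v <= t -> (F u v <= w u v)%E) ->
  (partition_sup F s t <= w s t)%E.
Proof.
move=> wc Fw; apply: ge_ereal_sup => _ [l lst <-].
exact: partition_sum_le_control.
Qed.

(** * Integrals of increments *)

(** Multiplied by h^(- delta p), this is the p-th power of the quantity whose
    supremum over h is the Nikolskii seminorm. *)
Definition increment_integral (R : realType) (E : metricType R) (p : R)
    (f : R -> E) (h a b : R) : \bar R :=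
  (\int[lebesgue_measure]_(u in `[a, (b - h)%R])
     (mdist (f u) (f (u + h)) `^ p)%:E)%E.

Lemma increment_integral_ge0 (R : realType) (E : metricType R) (p : R)
    (f : R -> E) (h a b : R) : (0 <= increment_integral p f h a b)%E.
Proof. by apply: integral_ge0 => x _; rewrite lee_fin powR_ge0. Qed.

Lemma measurable_addr (R : realType) (d : R) :
  measurable_fun [set: R] (fun u : R => u + d).
Proof. by apply: measurable_funD. Qed.

Lemma measurable_increment (R : realType) (E : metricType R) (f : R -> E)
    (h : R) : continuous f ->
  measurable_fun [set: R] (fun u => mdist (f u) (f (u + h))).
Proof.
move=> /measurable_mdist mf.
apply: (measurableT_comp mf (_ : measurable_fun _ (fun u : R => (u, u + h)))).
by apply: measurable_fun_pair => //; exact: measurable_addr.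
Qed.

Lemma measurable_increment_powR (R : realType) (E : metricType R) (p : R)
    (f : R -> E) (h : R) : continuous f ->
  measurable_fun [set: R] (fun u => (mdist (f u) (f (u + h)) `^ p)%:E).
Proof.
move=> cf; apply/measurable_EFinP.
apply: (measurableT_comp (measurable_powR p)).
exact: measurable_increment.
Qed.

(** Folding a long interval onto its first block of length h. *)
Lemma ge0_integral_blocks (R : realType) (G : R -> \bar R) (s h : R) (N : nat) :
  0 <= h -> measurable_fun [set: R] G -> (forall x, 0 <= G x)%E ->
  (\int[lebesgue_measure]_(x in `[s, (s + N%:R * h)%R]) G x =
   \int[lebesgue_measure]_(x in `[s, (s + h)%R])
      \sum_(j < N) G (x + j%:R * h)%R)%E.
Proof.
move=> h0 mG G0.
have mGs d : measurable_fun [set: R] (fun x => G (x + d)).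
  exact: (measurableT_comp mG (@measurable_addr R d)).
rewrite ge0_integral_sum//; last by move=> n; exact: (measurable_funTS (mGs _)).
elim: N => [|N ih].
  by rewrite mul0r addr0 big_ord0 set_itv1 integral_set1.
have sN : s <= s + N%:R * h by rewrite lerDl mulr_ge0.
have NN : s + N%:R * h <= s + N.+1%:R * h by rewrite lerD2l ler_wpM2r// ler_nat.
rewrite big_ord_recr/= -ih.
rewrite (ge0_integral_itv_split mG G0 sN NN); congr (_ + _)%E.
have -> : s + N.+1%:R * h = (s + h) + N%:R * h by rewrite -natr1; ring.
by rewrite ge0_integral_shift_itv//; exact: measurable_funTS.
Qed.

(** * Controlled paths: bounds for the Nikolskii seminorm *)

(** The case q = delta p - 1 is the one of interest: w then dominates the
    summands of the V seminorm. *)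
Definition controlled (R : realType) (E : metricType R) (p q : R)
    (f : R -> E) (w : R -> R -> \bar R) (s t : R) : Prop :=
  control w s t /\ forall u v, s <= u -> u < v -> v <= t ->
    ((mdist (f u) (f v) `^ p)%:E <= ((v - u) `^ q)%:E * w u v)%E.

Lemma controlledS (R : realType) (E : metricType R) (p q : R) (f : R -> E)
    (w : R -> R -> \bar R) (s t s' t' : R) :
  controlled p q f w s t -> s <= s' -> t' <= t -> controlled p q f w s' t'.
Proof.
move=> [wc fw] ss' tt'; split; first exact: controlS wc ss' tt'.
move=> u v su uv vt; apply: fw => //; first exact: le_trans ss' su.
exact: le_trans vt tt'.
Qed.

(** The points x + j h that remain below t - h are the left ends of adjacent
    intervals of length h inside [x, t], so that superadditivity applies; the
    truncation in the summand discards the other ones. *)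
Lemma sum_translates_le (R : realType) (E : metricType R) (p q : R)
    (f : R -> E) (w : R -> R -> \bar R) (s t h : R) (N : nat) (x : R) :
  controlled p q f w s t -> 0 < h -> s <= x -> x <= t ->
  (\sum_(j < N)
     (if (x + j%:R * h <= t - h)%R
      then (mdist (f (x + j%:R * h)) (f (x + j%:R * h + h)) `^ p)%:E else 0)
   <= (h `^ q)%:E * w x t)%E.
Proof.
move=> [wc fw] h0; elim: N x => [|N ih] x sx xt.
  by rewrite big_ord0 mule_ge0 ?lee_fin ?powR_ge0 ?(control_ge0 wc).
have [xth|xth] := leP x (t - h); last first.
  rewrite big1 ?mule_ge0 ?lee_fin ?powR_ge0 ?(control_ge0 wc)// => j _.
  by rewrite leNgt ltr_wpDr// mulr_ge0// ltW.
have xh : x + h <= t by lra.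
have xxh : x <= x + h by lra.
have sxh : s <= x + h by lra.
rewrite big_ord_recl/= mul0r addr0 xth.
under eq_bigr => j _.
  have -> : x + (bump 0 j)%:R * h = x + h + j%:R * h.
    by rewrite /bump/= natrD mulrDl mul1r addrA.
  over.
apply: (@le_trans _ _
  ((h `^ q)%:E * w x (x + h)%R + (h `^ q)%:E * w (x + h)%R t)%E).
  rewrite leeD//.
    have -> : (h `^ q = (x + h - x) `^ q)%R by congr (_ `^ _); ring.
    by apply: fw => //; lra.
  exact: ih.
rewrite -ge0_muleDr ?(control_ge0 wc)//.
by rewrite lee_wpmul2l ?lee_fin ?powR_ge0// (control_superadditive wc).
Qed.

(** Folding [s, t - h] onto [s, s + h] turns the integrand into sums of p-th
    powers of increments over adjacent intervals of length h; each sum is at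
    most h^q w(s, t), and the block contributes the extra factor h. *)
Lemma increment_integral_le_control (R : realType) (E : metricType R) (p q : R)
    (f : R -> E) (w : R -> R -> \bar R) (s t h : R) :
  continuous f -> controlled p q f w s t -> 0 < h -> h <= t - s ->
  (increment_integral p f h s t <= (h `^ (q + 1))%:E * w s t)%E.
Proof.
move=> cf fw h0 hts; have wc := fw.1.
pose G (x : R) : \bar R :=
  if x <= t - h then (mdist (f x) (f (x + h)) `^ p)%:E else 0%E.
have G0 x : (0 <= G x)%E by rewrite /G; case: ifP; rewrite ?lee_fin ?powR_ge0.
have mG : measurable_fun [set: R] G.
  apply: measurable_fun_ifT => //.
    by apply: measurable_fun_ler => //.
  exact: measurable_increment_powR.
(* Enough blocks to cover [s, t - h]; G vanishes beyond t - h. *)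
pose N := (Num.truncn ((t - s) / h)).+1.
have tN : t - h <= s + N%:R * h.
  have : (t - s) / h < N%:R by exact: truncnS_gt.
  by rewrite ltr_pdivrMr// => ?; lra.
have -> : increment_integral p f h s t =
    (\int[lebesgue_measure]_(x in `[s, (t - h)%R]) G x)%E.
  by apply: eq_integral => x; rewrite inE/= in_itv/= /G => /andP[_ ->].
apply: (@le_trans _ _
    (\int[lebesgue_measure]_(x in `[s, (s + N%:R * h)%R]) G x)%E).
  apply: ge0_subset_integral => //; first exact: measurable_funTS.
  by move=> x /=; rewrite !in_itv/= => /andP[-> /= xth]; exact: le_trans tN.
rewrite ge0_integral_blocks//; last exact: ltW.
apply: (@le_trans _ _ (\int[lebesgue_measure]_(x in `[s, (s + h)%R])
    cst ((h `^ q)%:E * w s t) x)%E).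
  apply: ge0_le_integral => //.
  - by move=> x _; rewrite sume_ge0.
  - apply: emeasurable_sum => j; apply: measurable_funTS.
    exact: (measurableT_comp mG (@measurable_addr R _)).
  - move=> x /=; rewrite in_itv/= => /andP[sx xsh].
    have xt : x <= t by lra.
    rewrite (le_trans (sum_translates_le _ fw h0 sx xt))//.
    rewrite lee_wpmul2l ?lee_fin ?powR_ge0//.
    exact: control_le wc (lexx s) sx xt (lexx t) (lexx t).
rewrite integral_cst//= lebesgue_measure_itv/= lte_fin ltrDl h0.
rewrite -EFinB addrAC subrr add0r muleAC -EFinM.
by rewrite powRD ?(lt0r_neq0 h0) ?implybT// powRr1// ltW.
Qed.

Lemma NnormE (R : realType) (E : metricType R) (delta p : R) (f : R -> E)
    (s t : R) :
  Nnorm delta p f s t = ereal_sup [set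
    ((h `^ (- delta))%:E * increment_integral p f h s t `^ p^-1)%E
    | h in `]0, (t - s)]].
Proof. by []. Qed.

Lemma Nnorm_ge0 (R : realType) (E : metricType R) (delta p : R) (f : R -> E)
    (s t : R) : s < t -> (0 <= Nnorm delta p f s t)%E.
Proof.
move=> st; apply: le_ereal_sup_tmp; eexists.
  by exists (t - s) => //; rewrite /= in_itv/= subr_gt0 st lexx.
by rewrite mule_ge0 ?lee_fin ?powR_ge0 ?poweR_ge0.
Qed.

Lemma Nnorm_le_control (R : realType) (E : metricType R) (delta p : R)
    (f : R -> E) (w : R -> R -> \bar R) (s t : R) :
  0 < p -> continuous f -> s < t -> controlled p (delta * p - 1) f w s t ->
  (Nnorm delta p f s t `^ p <= w s t)%E.
Proof.
move=> p0 cf st fw; have wc := fw.1.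
have w0 : (0 <= w s t)%E by rewrite (control_ge0 wc)// ltW.
have -> : (w s t = (w s t `^ p^-1) `^ p)%E.
  by rewrite -poweRrM mulVf ?lt0r_neq0// poweRe1.
have Nw : (Nnorm delta p f s t <= w s t `^ p^-1)%E.
  rewrite NnormE; apply: ge_ereal_sup => _ [h + <-].
  rewrite /= in_itv/= => /andP[h0 hts].
  have := increment_integral_le_control cf fw h0 hts; rewrite subrK.
  move=> /(@gt0_ler_poweR _ p^-1).
  rewrite !in_itv/= !leey !increment_integral_ge0 invr_ge0 ltW//.
  rewrite mule_ge0 ?lee_fin ?powR_ge0// => /(_ isT isT isT).
  rewrite poweRM ?lee_fin ?powR_ge0// poweR_EFin -powRrM mulfK ?lt0r_neq0//.
  move=> /(lee_wpmul2l (_ : 0 <= (h `^ (- delta))%:E)%E).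
  rewrite lee_fin powR_ge0 => /(_ isT) /le_trans; apply.
  rewrite muleA -EFinM powRN mulVf ?mul1e//.
  by rewrite gt_eqF// powR_gt0.
apply: gt0_ler_poweR => //; first exact: ltW.
- by rewrite in_itv/= Nnorm_ge0 ?leey.
- by rewrite in_itv/= poweR_ge0 leey.
Qed.

(** * Dyadic recursions *)

(** A linear substitute for Jensen's inequality: after integration against a
    probability measure, choosing for c the p-th root of the mean of x^p bounds
    the mean of x by twice c.  Either x is below the threshold c, or
    x^(p - 1) exceeds c^(p - 1). *)
Lemma le_threshold_powR (R : realType) (p c x : R) :
  1 <= p -> 0 < c -> 0 <= x ->
  x <= c + c `^ (1 - p) * x `^ p.
Proof.
move=> p1 c0 x0; have [xc|cx] := leP x c.
  by rewrite (le_trans xc)// lerDl mulr_ge0 ?powR_ge0.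
have x_gt0 : 0 < x by exact: lt_trans cx.
rewrite (@le_trans _ _ (c `^ (1 - p) * x `^ p))// ?lerDr ?(ltW c0)//.
have p0 : 0 < p by exact: lt_le_trans p1.
rewrite -(mulr_powRB1 x0 p0) mulrCA ler_pMr// -opprB powRN mulrC.
rewrite ler_pdivlMr ?powR_gt0// mul1r.
by apply: ge0_ler_powR; rewrite ?nnegrE ?subr_ge0// ltW.
Qed.

(** The quantity b_n - M / (1 - r) r^n does not decrease with n, and b_n is at
    most e for some n. *)
Lemma geometric_recursion_bound (R : realType) (b : nat -> R) (M r : R) :
  0 <= M -> 0 < r -> r < 1 -> (forall n, b n <= b n.+1 + M * r ^+ n) ->
  (forall e, 0 < e -> exists n, b n <= e) -> b 0%N <= M / (1 - r).
Proof.
move=> M0 r0 r1 bS b0; apply/ler_addgt0Pl => e /b0[n bne].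
have r1' : 0 < 1 - r by rewrite subr_gt0.
have main : b 0%N - M / (1 - r) <= b n - M / (1 - r) * r ^+ n.
  elim: n {bne} => [|n ih]; first by rewrite expr0 mulr1.
  apply: (le_trans ih).
  have -> : M / (1 - r) * r ^+ n = M / (1 - r) * r ^+ n.+1 + M * r ^+ n.
    rewrite exprS; field; exact: lt0r_neq0.
  by have := bS n; lra.
have : 0 <= M / (1 - r) * r ^+ n.
  by rewrite mulr_ge0 ?exprn_ge0 ?divr_ge0// ltW.
by lra.
Qed.

Lemma dyadic_powR (R : realType) (al h : R) (n : nat) : 0 <= h ->
  (h / 2 ^+ n) `^ al = h `^ al * (2 `^ (- al)) ^+ n.
Proof.
move=> h0; rewrite powRM ?invr_ge0 ?exprn_ge0//.
apply: (congr1 ( *%R (h `^ al))).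
have -> : (2 ^+ n)^-1 = 2 `^ (- n%:R) :> R by rewrite powR_invn.
rewrite -(powR_mulrn n (powR_ge0 2 (- al))) -!powRrM.
by rewrite !mulNr mulrC.
Qed.

Lemma powR2N_lt1 (R : realType) (al : R) : 0 < al -> 2 `^ (- al) < 1 :> R.
Proof.
move=> al0; rewrite powRN invf_lt1 ?powR_gt0//.
have : 1 `^ al < 2 `^ al :> R.
  by apply: gt0_ltr_powR; rewrite ?nnegrE ?ler01 ?ler0n ?ltr1n.
by rewrite powR1.
Qed.

(** Applied to I(l), the integral of the distance to an endpoint over an
    interval of length l at this endpoint.  The hypotheses relate the means
    I(l) / l at successive dyadic scales with errors of order h^al, which are
    summable down to scale 0, where the mean tends to 0.  The factor 2 in the
    recursion must match the ratio of scales exactly: a larger one would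
    accumulate over infinitely many steps. *)
Lemma dyadic_recursion_bound (R : realType) (I : R -> R) (al M h l : R) :
  0 < al -> 0 <= M -> 0 < h -> h <= l ->
  I l <= 2 * I h + 2 * M * h `^ (1 + al) ->
  (forall n, I (h / 2 ^+ n) <= 2 * I (h / 2 ^+ n.+1) +
     2 * M * (h / 2 ^+ n.+1) `^ (1 + al)) ->
  (forall e, 0 < e -> exists n, I (h / 2 ^+ n) <= e * (h / 2 ^+ n)) ->
  I l <= 2 * (1 + (1 - 2 `^ (- al))^-1) * M * l `^ (1 + al).
Proof.
move=> al0 M0 h0 hl Il IS I0.
set r : R := 2 `^ (- al).
have r0 : 0 < r by exact: powR_gt0.
have r1 : r < 1 by exact: powR2N_lt1.
have hn n : 0 < h / 2 ^+ n by rewrite divr_gt0// exprn_gt0.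
have hS n : h / 2 ^+ n = 2 * (h / 2 ^+ n.+1).
  by rewrite exprS; field; rewrite expf_neq0.
have powR1D x : 0 < x -> x `^ (1 + al) = x * x `^ al.
  by move=> x0; rewrite powRD ?(lt0r_neq0 x0) ?implybT// powRr1// ltW.
have hr n : (h / 2 ^+ n.+1) `^ al <= h `^ al * r ^+ n.
  rewrite dyadic_powR ?(ltW h0)// ler_wpM2l ?powR_ge0// exprS.
  by rewrite ler_piMl ?exprn_ge0 ?(ltW r0) ?(ltW r1).
have := @geometric_recursion_bound R (fun n => I (h / 2 ^+ n) / (h / 2 ^+ n))
  (M * h `^ al) r.
rewrite mulr_ge0 ?powR_ge0// => /(_ isT r0 r1); rewrite expr0 divr1.
have step n : I (h / 2 ^+ n) / (h / 2 ^+ n) <=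
    I (h / 2 ^+ n.+1) / (h / 2 ^+ n.+1) + M * h `^ al * r ^+ n.
  have x0 := hn n.+1.
  have := IS n; rewrite powR1D// hS; set x := h / 2 ^+ n.+1 in x0 *.
  move=> Ix; have Mx : M * x `^ al <= M * h `^ al * r ^+ n.
    by rewrite -mulrA ler_wpM2l// hr.
  rewrite ler_pdivrMr ?mulr_gt0//.
  have -> : (I x / x + M * h `^ al * r ^+ n) * (2 * x) =
      2 * I x + M * h `^ al * r ^+ n * (2 * x).
    by field; exact: lt0r_neq0.
  by apply: (le_trans Ix); rewrite lerD2l; nra.
move=> /(_ step) main.
have : I h / h <= M * h `^ al / (1 - r).
  apply: main => e e0; have [n In] := I0 _ e0; exists n.
  by rewrite ler_pdivrMr.
rewrite ler_pdivrMr// => Ih; apply: (le_trans Il).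
have hl' : h `^ (1 + al) <= l `^ (1 + al).
  by apply: ge0_ler_powR; rewrite ?nnegrE ?addr_ge0// ltW// (lt_le_trans h0).
apply: (@le_trans _ _ (2 * (1 + (1 - r)^-1) * M * h `^ (1 + al))).
  rewrite powR1D//.
  have -> : 2 * (1 + (1 - r)^-1) * M * (h * h `^ al) =
    2 * (M * h `^ al / (1 - r) * h) + 2 * M * (h * h `^ al) by ring.
  by rewrite lerD2r ler_pM2l.
by rewrite ler_wpM2l// !mulr_ge0// addr_ge0// invr_ge0 subr_ge0 ltW.
Qed.

(** * From increment integrals to pointwise bounds *)

Lemma measurable_dist_from (R : realType) (E : metricType R) (f : R -> E)
    (c : E) : continuous f ->
  measurable_fun [set: R] (fun x => (mdist c (f x))%:E).
Proof.
move=> cf; apply/measurable_EFinP.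
by apply: continuous_measurable_fun; exact: continuous_mdist.
Qed.

Lemma dist_from_integral_fin_num (R : realType) (E : metricType R)
    (f : R -> E) (c : E) (a b : R) : continuous f ->
  (\int[lebesgue_measure]_(x in `[a, b]) (mdist c (f x))%:E)%E \is a fin_num.
Proof.
move=> cf; apply: integrable_fin_num => //.
apply: continuous_compact_integrable; first exact: segment_compact.
by apply: continuous_subspaceT; exact: continuous_mdist.
Qed.

(** Translation by h maps [a, a + l - h] onto [a + h, a + l], and the triangle
    inequality passes through the translated point. *)
Lemma integral_dist_left_step (R : realType) (E : metricType R) (f : R -> E)
    (c : E) (a h l : R) : continuous f -> 0 < h -> h <= l -> l <= 2 * h ->
  (\int[lebesgue_measure]_(x in `[a, (a + l)%R]) (mdist c (f x))%:E <=
   2%:E * \int[lebesgue_measure]_(x in `[a, (a + h)%R]) (mdist c (f x))%:E +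
   \int[lebesgue_measure]_(x in `[a, (a + l - h)%R])
     (mdist (f x) (f (x + h)))%:E)%E.
Proof.
move=> cf h0 hl lh.
have mf := measurable_dist_from c cf.
have mD : measurable_fun [set: R] (fun u => (mdist (f u) (f (u + h)))%:E).
  by apply/measurable_EFinP; exact: measurable_increment.
have f0 x : (0 <= (mdist c (f x))%:E)%E by rewrite lee_fin mdist_ge0.
have D0 x : (0 <= (mdist (f x) (f (x + h)))%:E)%E by rewrite lee_fin mdist_ge0.
have [ah hl'] : a <= a + h /\ a + h <= a + l by split; lra.
rewrite (@ge0_integral_itv_split _ _ a (a + h))//.
rewrite (_ : 2%:E = 1 + 1)%E// ge0_muleDl// mul1e -[leRHS]addeA; apply: leeD2l.
have -> : a + l = a + l - h + h by ring.
rewrite ge0_integral_shift_itv//; last exact: measurable_funTS.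
rewrite addrK; apply: (@le_trans _ _
  (\int[lebesgue_measure]_(x in `[a, (a + l - h)%R])
     ((mdist c (f x))%:E + (mdist (f x) (f (x + h)))%:E))%E).
  apply: ge0_le_integral => //.
  - exact: (measurable_funTS (measurableT_comp mf (@measurable_addr R h))).
  - by apply: emeasurable_funD; exact: measurable_funTS.
  - by move=> x _; rewrite -EFinD lee_fin metric_triangle.
rewrite ge0_integralD//; [|exact: measurable_funTS..].
by apply: leeD2r; apply: ge0_itv_integral_le => //; lra.
Qed.

Lemma integral_dist_right_step (R : realType) (E : metricType R) (f : R -> E)
    (c : E) (b h l : R) : continuous f -> 0 < h -> h <= l -> l <= 2 * h ->
  (\int[lebesgue_measure]_(x in `[(b - l)%R, b]) (mdist c (f x))%:E <=
   2%:E * \int[lebesgue_measure]_(x in `[(b - h)%R, b]) (mdist c (f x))%:E +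
   \int[lebesgue_measure]_(x in `[(b - l)%R, (b - h)%R])
     (mdist (f x) (f (x + h)))%:E)%E.
Proof.
move=> cf h0 hl lh.
have mf := measurable_dist_from c cf.
have mD : measurable_fun [set: R] (fun u => (mdist (f u) (f (u + h)))%:E).
  by apply/measurable_EFinP; exact: measurable_increment.
have f0 x : (0 <= (mdist c (f x))%:E)%E by rewrite lee_fin mdist_ge0.
have D0 x : (0 <= (mdist (f x) (f (x + h)))%:E)%E by rewrite lee_fin mdist_ge0.
have [lb hb] : b - l <= b - h /\ b - h <= b by split; lra.
rewrite (@ge0_integral_itv_split _ _ _ (b - h))//.
rewrite (_ : 2%:E = 1 + 1)%E// ge0_muleDl// mul1e [leLHS]addeC -[leRHS]addeA.
apply: leeD2l.
apply: (@le_trans _ _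
  (\int[lebesgue_measure]_(x in `[(b - l)%R, (b - h)%R])
     ((mdist c (f (x + h)))%:E + (mdist (f x) (f (x + h)))%:E))%E).
  apply: ge0_le_integral => //.
  - exact: measurable_funTS.
  - apply: emeasurable_funD; last exact: measurable_funTS.
    exact: (measurable_funTS (measurableT_comp mf (@measurable_addr R h))).
  - move=> x _; rewrite -EFinD lee_fin [mdist (f x) _]metric_sym.
    exact: metric_triangle.
rewrite ge0_integralD//; last 2 first.
- exact: (measurable_funTS (measurableT_comp mf (@measurable_addr R h))).
- exact: measurable_funTS.
apply: leeD2r.
rewrite -(@ge0_integral_shift_itv _ h _ _ (fun x => (mdist c (f x))%:E))//.
  by apply: ge0_itv_integral_le => //; lra.
exact: measurable_funTS.
Qed.

Lemma integral_dist_le_increment (R : realType) (E : metricType R) (f : R -> E)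
    (p c a b h u v : R) : continuous f -> 1 <= p -> 0 < c -> 0 < h ->
  a <= u -> v <= b - h -> v - u <= h ->
  (\int[lebesgue_measure]_(x in `[u, v]) (mdist (f x) (f (x + h)))%:E <=
   (c * h)%:E + (c `^ (1 - p))%:E * increment_integral p f h a b)%E.
Proof.
move=> cf p1 c0 h0 au vb vuh.
have mD := measurable_increment_powR p h cf.
apply: (@le_trans _ _ (\int[lebesgue_measure]_(x in `[u, v])
  (cst c%:E x + (c `^ (1 - p))%:E * (mdist (f x) (f (x + h)) `^ p)%:E))%E).
  apply: ge0_le_integral => //.
  - by move=> x _; rewrite lee_fin mdist_ge0.
  - apply/measurable_EFinP; apply: measurable_funTS.
    exact: measurable_increment.
  - apply: measurable_funTS; apply: emeasurable_funD => //.
    exact: measurable_funeM.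
  - move=> x _; rewrite -EFinM -EFinD lee_fin.
    by apply: le_threshold_powR => //; exact: mdist_ge0.
rewrite ge0_integralD//=; last 3 first.
- by move=> x _; rewrite lee_fin ltW.
- by move=> x _; rewrite -EFinM lee_fin mulr_ge0 ?powR_ge0.
- by apply: measurable_funTS; exact: measurable_funeM.
rewrite ge0_integralZl_EFin ?powR_ge0//; last 2 first.
- by move=> x _; rewrite lee_fin powR_ge0.
- exact: measurable_funTS.
rewrite leeD//; last first.
  rewrite lee_wpmul2l ?lee_fin ?powR_ge0// ge0_itv_integral_le// => x.
  by rewrite lee_fin powR_ge0.
rewrite integral_cst//= lebesgue_measure_itv/= lte_fin.
case: ifPn => _; last by rewrite mule0 lee_fin mulr_ge0// ltW.
by rewrite -EFinB -EFinM lee_fin ler_pM2l.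
Qed.

Lemma dyadic_lt (R : realType) (h r : R) : 0 < h -> 0 < r ->
  exists n, h / 2 ^+ n < r.
Proof.
move=> h0 r0; exists (Num.truncn (h / r)).+1.
rewrite ltr_pdivrMr ?exprn_gt0// mulrC -ltr_pdivrMr//.
apply: (lt_trans (truncnS_gt _)).
by rewrite -natrX ltr_nat ltn_expl.
Qed.

Lemma integral_dist_small (R : realType) (E : metricType R) (f : R -> E)
    (c e : R) : continuous f -> 0 < e -> exists2 r, 0 < r &
  forall a b, c - r < a -> a <= b -> b < c + r ->
  (\int[lebesgue_measure]_(x in `[a, b]) (mdist (f c) (f x))%:E
     <= (e * (b - a))%:E)%E.
Proof.
move=> cf e0.
have [/= r r0 fr] := metricType_numDomainType.cvgr_dist_lt (cf c) e0.
exists r => // a b ca ab bc.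
apply: (@le_trans _ _ (\int[lebesgue_measure]_(x in `[a, b]) cst e%:E x)%E).
  apply: ge0_le_integral => //.
  - by move=> x _; rewrite lee_fin mdist_ge0.
  - by apply: measurable_funTS; exact: measurable_dist_from.
  - move=> x /=; rewrite in_itv/= => /andP[ax xb]; rewrite lee_fin ltW//.
    by apply: fr; rewrite /= ltr_distlC; apply/andP; split; lra.
rewrite integral_cst//= lebesgue_measure_itv/= lte_fin.
case: ifPn => _; first by rewrite -EFinB -EFinM.
by rewrite mule0 lee_fin mulr_ge0 ?subr_ge0// ltW.
Qed.

(** With M^p a bound for the rescaled increment integral, the threshold
    c = M h^(delta - 1/p) balances the two terms of
    [integral_dist_le_increment]. *)
Lemma integral_increment_le (R : realType) (E : metricType R) (f : R -> E)
    (delta p M a b h u v : R) : continuous f -> 1 <= p -> 0 < M -> 0 < h ->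
  (increment_integral p f h a b <= (h `^ (delta * p) * M `^ p)%:E)%E ->
  a <= u -> v <= b - h -> v - u <= h ->
  (\int[lebesgue_measure]_(x in `[u, v]) (mdist (f x) (f (x + h)))%:E <=
   (2 * M * h `^ (1 + (delta - p^-1)))%:E)%E.
Proof.
move=> cf p1 M0 h0 incM au vb vuh.
have p0 : p != 0 by rewrite gt_eqF// (lt_le_trans _ p1).
set al := delta - p^-1.
have c0 : 0 < M * h `^ al by rewrite mulr_gt0 ?powR_gt0.
apply: (le_trans (integral_dist_le_increment cf p1 c0 h0 au vb vuh)).
apply: (@le_trans _ _ ((M * h `^ al * h)%:E +
   ((M * h `^ al) `^ (1 - p))%:E * (h `^ (delta * p) * M `^ p)%:E)%E).
  by apply: leeD2l; apply: lee_wpmul2l => //; rewrite lee_fin powR_ge0.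
have hD r s : h `^ (r + s) = h `^ r * h `^ s.
  by rewrite powRD// (lt0r_neq0 h0) implybT.
rewrite -EFinM -EFinD lee_fin powRM ?powR_ge0 ?(ltW M0)// -powRrM.
have -> : M `^ (1 - p) * h `^ (al * (1 - p)) * (h `^ (delta * p) * M `^ p) =
    (M `^ (1 - p) * M `^ p) * (h `^ (al * (1 - p)) * h `^ (delta * p)) by ring.
rewrite -hD -powRD ?(lt0r_neq0 M0) ?implybT// subrK powRr1 ?(ltW M0)//.
have -> : al * (1 - p) + delta * p = 1 + al by rewrite /al; field.
by rewrite (hD 1) powRr1 ?(ltW h0)//; lra.
Qed.

(** The averaged form of the fractional Sobolev embedding into Hoelder
    functions, using only the shifts h / 2^n.  Averaging from each endpoint
    replaces the values of f by means, for which the increment integrals give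
    bounds. *)
Lemma dist_le_of_increment_integral (R : realType) (E : metricType R)
    (f : R -> E) (delta p M a b h : R) :
  continuous f -> 1 <= p -> p^-1 < delta -> 0 < M -> 0 < h -> h <= b - a ->
  b - a <= 2 * h ->
  (forall n, increment_integral p f (h / 2 ^+ n) a b <=
     ((h / 2 ^+ n) `^ (delta * p) * M `^ p)%:E)%E ->
  mdist (f a) (f b) <= 4 * (1 + (1 - 2 `^ (- (delta - p^-1)))^-1) * M *
    (b - a) `^ (delta - p^-1).
Proof.
move=> cf p1 pd M0 h0 hba bah inc.
set al := delta - p^-1; have al0 : 0 < al by rewrite subr_gt0.
set K := 1 + (1 - 2 `^ (- al))^-1.
have hn n : 0 < h / 2 ^+ n by rewrite divr_gt0// exprn_gt0.
have hS n : h / 2 ^+ n = 2 * (h / 2 ^+ n.+1).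
  by rewrite exprS; field; rewrite expf_neq0.
have hh n : h / 2 ^+ n <= h.
  by rewrite ler_pdivrMr ?exprn_gt0// ler_peMr ?(ltW h0)// exprn_ege1// ler1n.
have fin c x y := dist_from_integral_fin_num c x y cf.
have ab0 : 0 < b - a by exact: lt_le_trans hba.
have left_bound : fine (\int[lebesgue_measure]_(x in `[a, (a + (b - a))%R])
    (mdist (f a) (f x))%:E) <= 2 * K * M * (b - a) `^ (1 + al).
  have step n l : h / 2 ^+ n <= l -> l <= 2 * (h / 2 ^+ n) -> l <= b - a ->
    fine (\int[lebesgue_measure]_(x in `[a, (a + l)%R])
      (mdist (f a) (f x))%:E) <=
    2 * fine (\int[lebesgue_measure]_(x in `[a, (a + h / 2 ^+ n)%R])
      (mdist (f a) (f x))%:E) + 2 * M * (h / 2 ^+ n) `^ (1 + al).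
    move=> hl lh lab; rewrite -lee_fin EFinD EFinM !fineK//.
    apply: (le_trans (integral_dist_left_step _ _ cf (hn n) hl lh)).
    apply: leeD2l; apply: (integral_increment_le cf p1 M0 (hn n) (inc n)) => //;
      lra.
  apply: (@dyadic_recursion_bound R (fun l => fine
    (\int[lebesgue_measure]_(x in `[a, (a + l)%R]) (mdist (f a) (f x))%:E))
    al M h) => //.
  - exact: ltW.
  - by have := step 0%N (b - a); rewrite expr0 divr1; exact.
  - by move=> n; apply: step; have := hS n; have := hn n.+1; have := hh n; lra.
  - move=> e e0; have [r r0 fr] := integral_dist_small a cf e0.
    have [n hr] := dyadic_lt h0 r0; exists n; rewrite -lee_fin fineK//.
    rewrite [in leRHS](_ : h / 2 ^+ n = a + h / 2 ^+ n - a); last by ring.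
    by apply: fr; have := hn n; lra.
have right_bound : fine (\int[lebesgue_measure]_(x in `[(b - (b - a))%R, b])
    (mdist (f b) (f x))%:E) <= 2 * K * M * (b - a) `^ (1 + al).
  have step n l : h / 2 ^+ n <= l -> l <= 2 * (h / 2 ^+ n) -> l <= b - a ->
    fine (\int[lebesgue_measure]_(x in `[(b - l)%R, b])
      (mdist (f b) (f x))%:E) <=
    2 * fine (\int[lebesgue_measure]_(x in `[(b - h / 2 ^+ n)%R, b])
      (mdist (f b) (f x))%:E) + 2 * M * (h / 2 ^+ n) `^ (1 + al).
    move=> hl lh lab; rewrite -lee_fin EFinD EFinM !fineK//.
    apply: (le_trans (integral_dist_right_step _ _ cf (hn n) hl lh)).
    apply: leeD2l; apply: (integral_increment_le cf p1 M0 (hn n) (inc n)) => //;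
      lra.
  apply: (@dyadic_recursion_bound R (fun l => fine
    (\int[lebesgue_measure]_(x in `[(b - l)%R, b]) (mdist (f b) (f x))%:E))
    al M h) => //.
  - exact: ltW.
  - by have := step 0%N (b - a); rewrite expr0 divr1; exact.
  - by move=> n; apply: step; have := hS n; have := hn n.+1; have := hh n; lra.
  - move=> e e0; have [r r0 fr] := integral_dist_small b cf e0.
    have [n hr] := dyadic_lt h0 r0; exists n; rewrite -lee_fin fineK//.
    rewrite [in leRHS](_ : h / 2 ^+ n = b - (b - h / 2 ^+ n)); last by ring.
    by apply: fr; have := hn n; lra.
rewrite subKr in right_bound; rewrite addrC subrK in left_bound.
have : mdist (f a) (f b) * (b - a) <= 4 * K * M * (b - a) `^ (1 + al).
  apply: (@le_trans _ _ (fine (\int[lebesgue_measure]_(x in `[a, b])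
      (mdist (f a) (f x))%:E) + fine (\int[lebesgue_measure]_(x in `[a, b])
      (mdist (f b) (f x))%:E))); last by lra.
  rewrite -lee_fin EFinD !fineK// -ge0_integralD//; last 4 first.
  - by move=> x _; rewrite lee_fin mdist_ge0.
  - by apply: measurable_funTS; exact: measurable_dist_from.
  - by move=> x _; rewrite lee_fin mdist_ge0.
  - by apply: measurable_funTS; exact: measurable_dist_from.
  have -> : (mdist (f a) (f b) * (b - a))%:E =
      (\int[lebesgue_measure]_(x in `[a, b]) cst (mdist (f a) (f b))%:E x)%E.
    rewrite integral_cst//= lebesgue_measure_itv/= lte_fin -subr_gt0 ab0.
    by rewrite -EFinB -EFinM.
  apply: ge0_le_integral => //.
  - by move=> x _; rewrite lee_fin mdist_ge0.
  - by apply: emeasurable_funD; apply: measurable_funTS;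
      exact: measurable_dist_from.
  - move=> x _; rewrite -EFinD lee_fin [mdist (f b) _]metric_sym.
    exact: metric_triangle.
rewrite powRD ?(lt0r_neq0 ab0) ?implybT// powRr1 ?(ltW ab0)//.
by rewrite [(b - a) * _]mulrC [in leRHS]mulrA ler_pM2r.
Qed.

(** * The dyadic energy of a path *)

(** For r = delta p this is the p-th power of a Besov seminorm of smoothness
    delta and indices (p, p), sampled on one dyadic sequence of shifts. *)
Definition dyadic_energy (R : realType) (E : metricType R) (p r : R)
    (f : R -> E) (tau a b : R) : \bar R :=
  (\sum_(n <oo) ((tau / 2 ^+ n) `^ (- r))%:E *
                increment_integral p f (tau / 2 ^+ n)%R a b)%E.

(** The domains [a, b - h] and [b, c - h] are disjoint because h > 0, and both
    lie in [a, c - h]. *)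
Lemma increment_integral_superadditive (R : realType) (E : metricType R)
    (p : R) (f : R -> E) (h a b c : R) : continuous f -> 0 < h ->
  a <= b -> b <= c ->
  (increment_integral p f h a b + increment_integral p f h b c <=
   increment_integral p f h a c)%E.
Proof.
move=> cf h0 ab bc.
have mD := measurable_increment_powR p h cf.
rewrite /increment_integral -ge0_integral_setU//=; last 3 first.
- exact: measurable_funTS.
- by move=> x _; rewrite lee_fin powR_ge0.
- rewrite disj_set2E; apply/eqP/seteqP; split => // x [] /=.
  by rewrite !in_itv/= => /andP[_ ?] /andP[? _]; lra.
apply: ge0_subset_integral => //; first exact: measurableU.
- exact: measurable_funTS.
- by move=> x _; rewrite lee_fin powR_ge0.
by move=> x [] /=; rewrite !in_itv/= => /andP[? ?]; apply/andP; split; lra.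
Qed.

Lemma control_dyadic_energy (R : realType) (E : metricType R) (p r : R)
    (f : R -> E) (tau s t : R) : continuous f -> 0 < tau ->
  control (dyadic_energy p r f tau) s t.
Proof.
move=> cf tau0.
have term0 n a b : (0 <= ((tau / 2 ^+ n) `^ (- r))%:E *
    increment_integral p f (tau / 2 ^+ n)%R a b)%E.
  by rewrite mule_ge0 ?lee_fin ?powR_ge0 ?increment_integral_ge0.
split=> [a b _ _ _|a b c sa ab bc ct]; first by apply: nneseries_ge0.
rewrite -nneseriesD//; apply: lee_nneseries => [n _ _|n _].
  by rewrite adde_ge0.
rewrite -ge0_muleDr ?increment_integral_ge0//.
rewrite lee_wpmul2l ?lee_fin ?powR_ge0//.
by apply: increment_integral_superadditive => //; rewrite divr_gt0 ?exprn_gt0.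
Qed.

(** Adding the length keeps a control superadditive and makes it positive on
    nondegenerate intervals, so that it can serve as a threshold. *)
Lemma controlDlength (R : realType) (w : R -> R -> \bar R) (s t : R) :
  control w s t -> control (fun a b => w a b + (b - a)%:E)%E s t.
Proof.
move=> wc; split=> [a b sa ab bt|a b c sa ab bc ct].
  by rewrite adde_ge0 ?lee_fin ?subr_ge0// (control_ge0 wc).
rewrite addeACA -EFinD (_ : b - a + (c - b) = c - a); last by ring.
apply: leeD2r.
exact: (control_superadditive wc).
Qed.

Lemma controlZ (R : realType) (k : R) (w : R -> R -> \bar R) (s t : R) :
  0 <= k -> control w s t -> control (fun a b => k%:E * w a b)%E s t.
Proof.
move=> k0 wc; split=> [a b sa ab bt|a b c sa ab bc ct].
  by rewrite mule_ge0 ?lee_fin// (control_ge0 wc).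
have sb := le_trans sa ab; have bt := le_trans bc ct.
rewrite -ge0_muleDr ?(control_ge0 wc)//.
by rewrite lee_wpmul2l ?lee_fin// (control_superadditive wc).
Qed.

Lemma dyadic_scale (R : realType) (tau T l : R) : 0 < tau -> T <= 2 * tau ->
  0 < l -> l <= T -> exists2 n, tau / 2 ^+ n <= l & l <= 2 * (tau / 2 ^+ n).
Proof.
move=> tau0 Ttau l0 lT.
have ex : exists n, tau / 2 ^+ n <= l.
  by have [n /ltW] := dyadic_lt tau0 l0; exists n.
case: (ex_minnP ex) => -[|n] nl nmin; [exists 0%N|exists n.+1] => //.
  by rewrite expr0 divr1 (le_trans lT).
have : ~~ (tau / 2 ^+ n <= l).
  by apply/negP => /nmin; rewrite ltnn.
rewrite -ltNge => /ltW /le_trans; apply.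
suff -> : 2 * (tau / 2 ^+ n.+1) = tau / 2 ^+ n by [].
by rewrite exprS; field; rewrite expf_neq0.
Qed.

(** On [u, v], take M to be the p-th root of the energy plus the length: every
    term of the energy is then at most M^p, and the dyadic scale comparable to
    v - u starts the recursion of [dist_le_of_increment_integral]. *)
Lemma controlled_dyadic_energy (R : realType) (E : metricType R)
    (delta p : R) (f : R -> E) (tau T : R) :
  continuous f -> 1 < p -> p^-1 < delta -> 0 < tau -> T <= 2 * tau ->
  (dyadic_energy p (delta * p) f tau 0 T < +oo)%E ->
  controlled p (delta * p - 1) f
    (fun a b => ((4 * (1 + (1 - 2 `^ (- (delta - p^-1)))^-1)) `^ p)%:E *
      (dyadic_energy p (delta * p) f tau a b + (b - a)%:E))%E 0 T.
Proof.
move=> cf p1 pd tau0 Ttau fin.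
have p0 : p != 0 by rewrite gt_eqF// (lt_trans _ p1).
have ec := control_dyadic_energy p (delta * p) 0 T cf tau0.
split; first by apply: controlZ; [exact: powR_ge0|exact: controlDlength].
move=> u v u0 uv vT.
set C := 4 * _; set en := dyadic_energy _ _ _ _ u v.
have en0 : (0 <= en)%E by apply: (control_ge0 ec) => //; exact: ltW.
have enfin : en \is a fin_num.
  rewrite (ge0_fin_numE en0); apply: le_lt_trans fin.
  by apply: (control_le ec) => //; exact: ltW.
have vu0 : 0 < v - u by rewrite subr_gt0.
pose S := fine en + (v - u).
have S0 : 0 < S by rewrite ltr_wpDl// fine_ge0.
have vuT : v - u <= T by lra.
(* tau / 2 ^+ m is the dyadic scale lying between (v - u) / 2 and v - u. *)
have [m hm mh] := dyadic_scale tau0 Ttau vu0 vuT.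
have main : mdist (f u) (f v) <= C * S `^ p^-1 * (v - u) `^ (delta - p^-1).
  apply: (dist_le_of_increment_integral (h := tau / 2 ^+ m)) => //.
  - exact: ltW.
  - exact: powR_gt0.
  - by rewrite divr_gt0 ?exprn_gt0.
  move=> n; rewrite -mulrA -invfM -exprD.
  set h := tau / _; have h0 : 0 < h by rewrite divr_gt0 ?exprn_gt0.
  rewrite -[S `^ _ `^ _]powRrM mulVf// powRr1 ?(ltW S0)//.
  have : ((h `^ (- (delta * p)))%:E * increment_integral p f h u v <= S%:E)%E.
    apply: (@le_trans _ _ en); last first.
      by rewrite /S EFinD fineK// leeDl// lee_fin ltW.
    rewrite /en /dyadic_energy (nneseriesD1 (n := (m + n)%N))//; last first.
      move=> k _.
      by rewrite mule_ge0 ?lee_fin ?powR_ge0 ?increment_integral_ge0.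
    rewrite leeDl// nneseries_ge0// => k _ _.
    by rewrite mule_ge0 ?lee_fin ?powR_ge0 ?increment_integral_ge0.
  rewrite powRN muleC lee_pdivrMr ?powR_gt0//.
  by rewrite -EFinM mulrC.
have C0 : 0 <= C.
  rewrite /C mulr_ge0// addr_ge0// invr_ge0 subr_ge0 ltW// powR2N_lt1//.
  by rewrite subr_gt0.
have -> : (en + (v - u)%:E = S%:E)%E by rewrite /S (EFinD (fine en)) fineK.
rewrite -!EFinM lee_fin; clearbody C.
have -> : (v - u) `^ (delta * p - 1) * (C `^ p * S) =
    (C * S `^ p^-1 * (v - u) `^ (delta - p^-1)) `^ p.
  rewrite !powRM ?mulr_ge0 ?powR_ge0// -!powRrM mulVf// powRr1 ?(ltW S0)//.
  by rewrite mulrBl mulVf// mulrC.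
apply: ge0_ler_powR => //; rewrite ?nnegrE ?mdist_ge0//.
  by rewrite (le_trans _ (ltW p1)).
by rewrite !mulr_ge0 ?powR_ge0.
Qed.

(** * Finite energy from Nikolskii regularity *)

Lemma nneseries_geometric_lty (R : realType) (c r : R) :
  0 <= c -> 0 <= r -> r < 1 -> (\sum_(n <oo) (c * r ^+ n)%:E < +oo)%E.
Proof.
move=> c0 r0 r1.
have r1' : 0 < 1 - r by rewrite subr_gt0.
apply: (@le_lt_trans _ _ (c / (1 - r))%:E); last exact: ltry.
apply: lime_le.
  by apply: is_cvg_nneseries => n _ _; rewrite lee_fin mulr_ge0 ?exprn_ge0.
apply: nearW => n; rewrite sumEFin lee_fin.
have -> : \sum_(0 <= i < n) c * r ^+ i = c / (1 - r) - c / (1 - r) * r ^+ n.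
  elim: n => [|n ih]; first by rewrite big_geq// expr0 mulr1 subrr.
  by rewrite big_nat_recr//= ih exprS; field; exact: lt0r_neq0.
by rewrite gerBl mulr_ge0 ?exprn_ge0// divr_ge0// ltW.
Qed.

Lemma increment_integral_le_Nnorm (R : realType) (E : metricType R)
    (delta p : R) (f : R -> E) (s t h : R) : 0 < p -> 0 < h -> h <= t - s ->
  (Nnorm delta p f s t < +oo)%E ->
  (increment_integral p f h s t <=
     (h `^ (delta * p) * fine (Nnorm delta p f s t) `^ p)%:E)%E.
Proof.
move=> p0 h0 hts Nfin.
have N0 : (0 <= Nnorm delta p f s t)%E by apply: Nnorm_ge0; lra.
have Nf : Nnorm delta p f s t \is a fin_num by rewrite ge0_fin_numE.
have : ((h `^ (- delta))%:E * increment_integral p f h s t `^ p^-1 <=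
    Nnorm delta p f s t)%E.
  rewrite NnormE; apply: ereal_sup_ubound; exists h => //.
  by rewrite /= in_itv/= h0.
rewrite powRN muleC lee_pdivrMr ?powR_gt0// -[X in (_ <= X * _)%E]fineK//.
rewrite -EFinM => /(@gt0_ler_poweR _ p).
rewrite !in_itv/= !leey lee_fin !mulr_ge0 ?powR_ge0 ?fine_ge0 ?poweR_ge0//.
move=> /(_ (ltW p0) isT isT).
rewrite -poweRrM mulVf ?lt0r_neq0// poweRe1 ?increment_integral_ge0//.
rewrite powRM ?powR_ge0 ?fine_ge0// -powRrM.
by rewrite mulrC.
Qed.

(** The surplus regularity eps makes the n-th term decay like 2^(- n eps p). *)
Lemma dyadic_energy_lty_of_Nnorm (R : realType) (E : metricType R)
    (delta eps p T : R) (f : R -> E) : 0 < p -> 0 < eps -> 0 < T ->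
  (Nnorm (delta + eps) p f 0 T < +oo)%E ->
  (dyadic_energy p (delta * p) f T 0 T < +oo)%E.
Proof.
move=> p0 eps0 T0 Nfin.
set N := fine (Nnorm (delta + eps) p f 0 T).
have ep0 : 0 < eps * p by exact: mulr_gt0.
apply: (@le_lt_trans _ _
    (\sum_(n <oo) (T `^ (eps * p) * N `^ p * (2 `^ (- (eps * p))) ^+ n)%:E)%E).
  apply: lee_nneseries => n _.
    by rewrite mule_ge0 ?lee_fin ?powR_ge0 ?increment_integral_ge0.
  set h := T / 2 ^+ n.
  have h0 : 0 < h by rewrite divr_gt0 ?exprn_gt0.
  have hT : h <= T - 0.
    rewrite subr0 ler_pdivrMr ?exprn_gt0// ler_peMr ?(ltW T0)//.
    by rewrite exprn_ege1// ler1n.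
  have := increment_integral_le_Nnorm p0 h0 hT Nfin.
  move=> /(lee_wpmul2l (_ : 0 <= (h `^ (- (delta * p)))%:E)%E).
  rewrite lee_fin powR_ge0 => /(_ isT) /le_trans; apply.
  rewrite -EFinM lee_fin mulrA -powRD ?(lt0r_neq0 h0) ?implybT//.
  have -> : - (delta * p) + (delta + eps) * p = eps * p by ring.
  by rewrite /h dyadic_powR ?(ltW T0)// mulrAC.
apply: nneseries_geometric_lty.
- by rewrite mulr_ge0 ?powR_ge0.
- exact: powR_ge0.
- exact: powR2N_lt1.
Qed.

(** * Finite energy from Sobolev regularity *)

Lemma dyadic_itv_trivIset (R : realType) (T : R) : 0 < T ->
  trivIset [set: nat] (fun n => `](T / 2 ^+ n.+1), (T / 2 ^+ n)]%classic).
Proof.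
move=> T0; apply: ltn_trivIset => n m mn; apply/seteqP; split => // x [] /=.
rewrite !in_itv/= => /andP[lx _] /andP[_ xu].
have : T / 2 ^+ n <= T / 2 ^+ m.+1.
  by rewrite ler_pM2l// lef_pV2 ?posrE ?exprn_gt0// ler_eXn2l// ltr1n.
by lra.
Qed.

Lemma integral_dyadic_itv (R : realType) (T : R) (F : R -> \bar R) (n : nat) :
  measurable_fun [set: R] F -> (forall x, 0 <= F x)%E ->
  (\int[lebesgue_measure]_(x in `](T / 2 ^+ n.+1)%R, (T / 2 ^+ n)%R]) F x =
   \int[lebesgue_measure]_(x in `](T / 2)%R, T])
      ((2 ^- n)%:E * F (x / 2 ^+ n)%R))%E.
Proof.
move=> mF F0.
have c0 : 0 < 2 ^- n :> R by rewrite invr_gt0 exprn_gt0.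
have mFn : measurable_fun [set: R] (fun x => F (x / 2 ^+ n)).
  apply: (measurableT_comp mF (_ : measurable_fun _ (fun x : R => x / 2 ^+ n))).
  by apply: measurable_funM.
rewrite (ge0_integral_affine 0 c0)//; last exact: measurable_funTS.
rewrite ge0_integralZl_EFin ?(ltW c0)//; last exact: measurable_funTS.
have -> : (fun t => 2 ^- n * t + 0) @^-1` `]T / 2 ^+ n.+1, T / 2 ^+ n] =
    `]T / 2, T]%classic.
  rewrite -(preimage_affine_itv 0 (T / 2) T false false c0) !addr0.
  by rewrite exprS invfM ![2 ^- n * _]mulrC mulrA.
by congr (_ * _)%E; apply: eq_integral => x _; rewrite addr0 mulrC.
Qed.

Lemma integral_lty_exists (R : realType) (a b : R) (F : R -> \bar R) : a < b ->
  (\int[lebesgue_measure]_(x in `]a, b]) F x < +oo)%E ->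
  exists2 x, x \in `]a, b] & (F x < +oo)%E.
Proof.
move=> ab; apply: contraPP => /forall2NP nF.
have FE x : `]a, b]%classic x -> F x = +oo%E.
  by move=> xab; have [//|/negP] := nF x; rewrite -leNgt leye_eq => /eqP.
rewrite (eq_integral (cst +oo%E)); last by move=> x /[!inE] /FE.
rewrite integral_cst//= lebesgue_measure_itv/= lte_fin ab -EFinB.
by rewrite gt0_mulye ?lte_fin ?subr_gt0// ltxx.
Qed.

Lemma measurable_shear (R : realType) :
  measurable_fun [set: R * R] (fun z : R * R => (z.1, z.1 + z.2)).
Proof. by apply: measurable_fun_pair => //; apply: measurable_funD. Qed.

(** Tonelli after the change of variables y = x + h. *)
Lemma integral_square_shear (R : realType) (H : R * R -> \bar R) :
  measurable_fun [set: R * R] H -> (forall z, 0 <= H z)%E ->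
  (\int[lebesgue_measure \x lebesgue_measure]_z H z =
   \int[lebesgue_measure]_h \int[lebesgue_measure]_u H (u, (u + h)%R))%E.
Proof.
move=> mH H0.
have mS := measurableT_comp mH (@measurable_shear R).
rewrite fubini_tonelli1//.
transitivity (\int[lebesgue_measure]_u \int[lebesgue_measure]_h
    H (u, (u + h)%R))%E; last first.
  by apply: (@fubini_tonelli _ _ _ _ R lebesgue_measure lebesgue_measure
    (fun z : R * R => H (z.1, z.1 + z.2))).
apply: eq_integral => u _; rewrite /fubini_F.
rewrite [LHS](@ge0_integral_shiftT _ u)//.
  by apply: eq_integral => h _ /=; rewrite addrC.
exact: (measurableT_comp mH (pair1_measurable u)).
Qed.

(** For h > 0 let Psi(h) be the integral of the W integrand along the line
    y = x + h, which is at least h^(- 1 - delta p) times the increment integral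
    for the shift h.  Its integral over ]0, T] is the sum over n of 2^(- n)
    times the integral of Psi(x / 2^n) over x in ]T / 2, T].  Exchanging sum and
    integral shows that the sum of 2^(- n) Psi(x / 2^n), which dominates the
    energy at x divided by x, is finite for some x. *)
Lemma dyadic_energy_lty_of_Wnorm (R : realType) (E : metricType R)
    (delta p T : R) (f : R -> E) : continuous f -> 0 < p -> 0 < T ->
  (Wnorm delta p f 0 T < +oo)%E ->
  exists2 tau, T / 2 < tau <= T &
    (dyadic_energy p (delta * p) f tau 0 T < +oo)%E.
Proof.
move=> cf p0 T0; rewrite /Wnorm => /lty_poweRy.
rewrite invr_eq0 gt_eqF// => /(_ isT).
set Q := `[0, T] `*` `[0, T].
set G := fun z : R * R => _; rewrite integral_mkcond => HQ.
have mQ : measurable Q by exact: measurableX.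
have mG : measurable_fun [set: R * R] G.
  apply/measurable_EFinP; apply: measurable_funM.
    apply: (measurableT_comp (measurable_powR p)).
    exact: measurable_mdist.
  under eq_fun do rewrite -powRN.
  apply: (measurableT_comp (measurable_powR _)).
  apply: measurableT_comp => //.
  by apply: measurable_funB.
have mH : measurable_fun [set: R * R] (G \_ Q).
  by apply/(measurable_restrictT _ mQ); exact: measurable_funTS.
have H0 z : (0 <= (G \_ Q) z)%E.
  by rewrite patchE; case: ifP => // _; rewrite lee_fin divr_ge0 ?powR_ge0.
move: HQ; rewrite integral_square_shear//.
set Psi := fun h => _ => PsiT.
have mPsi : measurable_fun [set: R] Psi.
  apply: (@measurable_fun_fubini_tonelli_G _ _ _ _ R lebesgue_measure
    (fun z : R * R => (G \_ Q) (z.1, z.1 + z.2))) => //.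
  exact: (measurableT_comp mH (@measurable_shear R)).
have Psi0 h : (0 <= Psi h)%E by apply: integral_ge0.
have PsiE h : 0 < h -> ((h `^ (- (delta * p)))%:E *
    increment_integral p f h 0 T <= h%:E * Psi h)%E.
  move=> h0; apply: (@le_trans _ _ (h%:E *
    \int[lebesgue_measure]_(u in `[0%R, (T - h)%R])
       (G \_ Q) (u, (u + h)%R))%E); last first.
    rewrite lee_wpmul2l ?lee_fin ?(ltW h0)//.
    apply: ge0_subset_integral => //.
    exact: (measurableT_comp (measurableT_comp mH (@measurable_shear R))
      (pair2_measurable h)).
  have GE u : u \in `[0, (T - h)] -> (G \_ Q) (u, u + h) =
      ((h `^ (- (1 + delta * p)))%:E * (mdist (f u) (f (u + h)) `^ p)%:E)%E.
    rewrite in_itv/= => /andP[u0 uT].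
    rewrite patchE ifT; last first.
      by rewrite inE /Q /=; rewrite !in_itv/=; split; apply/andP; split; lra.
    rewrite /G /= addrAC subrr add0r gtr0_norm// powRN -EFinM.
    by rewrite mulrC.
  under eq_integral => u /[!inE] uT do rewrite GE//.
  rewrite ge0_integralZl_EFin ?powR_ge0//; last 2 first.
  - by move=> u _; rewrite lee_fin powR_ge0.
  - by apply: measurable_funTS; exact: measurable_increment_powR.
  rewrite muleA -EFinM; apply: lee_wpmul2r.
    exact: increment_integral_ge0.
  rewrite lee_fin opprD powRD ?(lt0r_neq0 h0) ?implybT// powR_inv1 ?(ltW h0)//.
  by rewrite mulrA divff ?mul1r// lt0r_neq0.
have : (\int[lebesgue_measure]_(x in `](T / 2)%R, T])
    \sum_(n <oo) ((2 ^- n)%:E * Psi (x / 2 ^+ n)%R) < +oo)%E.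
  have mPsin n : measurable_fun [set: R]
      (fun x => ((2 ^- n)%:E * Psi (x / 2 ^+ n)%R)%E).
    apply: measurable_funeM; apply: (measurableT_comp mPsi
      (_ : measurable_fun _ (fun x : R => x / 2 ^+ n))).
    by apply: measurable_funM.
  rewrite integral_nneseries//; last 2 first.
  - by move=> n; exact: (measurable_funTS (mPsin n)).
  - by move=> n x _; rewrite mule_ge0 ?lee_fin ?invr_ge0 ?exprn_ge0.
  under eq_eseriesr => n _ do rewrite -integral_dyadic_itv//.
  rewrite -ge0_integral_bigcup//; last 2 first.
  - exact: measurable_funTS.
  - exact: dyadic_itv_trivIset.
  apply: le_lt_trans PsiT; apply: ge0_subset_integral => //.
  exact: bigcupT_measurable.
have T2 : T / 2 < T by lra.
move=> /(integral_lty_exists T2)[tau]; rewrite in_itv/= => tauT fin.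
exists tau => //.
have tau0 : 0 < tau by case/andP: tauT => ? _; lra.
apply: (@le_lt_trans _ _
    (tau%:E * \sum_(n <oo) ((2 ^- n)%:E * Psi (tau / 2 ^+ n)%R))%E).
  have term0 n : (0 <= (2 ^- n)%:E * Psi (tau / 2 ^+ n)%R)%E.
    by rewrite mule_ge0 ?lee_fin ?invr_ge0 ?exprn_ge0.
  rewrite -nneseriesZl//; apply: lee_nneseries => n _.
    by rewrite mule_ge0 ?lee_fin ?powR_ge0 ?increment_integral_ge0.
  by rewrite muleA -EFinM PsiE// divr_gt0 ?exprn_gt0.
by rewrite lte_mul_pinfty ?lee_fin ?(ltW tau0).
Qed.

(** * Suprema over partitions as controls *)

Lemma partition_sum_cat (R : realType) (F : R -> R -> \bar R) (s : R)
    (l1 l2 : seq R) :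
  (partition_sum F s (l1 ++ l2) =
   partition_sum F s l1 + partition_sum F (last s l1) l2)%E.
Proof.
elim: l1 s => [|a l1 ih] s /=; first by rewrite [X in (X + _)%E]big_nil add0e.
by rewrite !partition_sum_cons ih addeA.
Qed.

Lemma partition_sum_ge0 (R : realType) (F : R -> R -> \bar R) (s : R)
    (l : seq R) : (forall u v, (0 <= F u v)%E) -> (0 <= partition_sum F s l)%E.
Proof. by move=> F0; apply: sume_ge0. Qed.

Lemma le_partition_sup (R : realType) (F : R -> R -> \bar R) (s t : R) :
  s < t -> (F s t <= partition_sup F s t)%E.
Proof.
move=> st; apply: ereal_sup_ubound; exists [:: t]; first exact: itv_partition1.
by rewrite partition_sum_cons /partition_sum big_nil adde0.
Qed.

(** Partitions of [a, b] and of [b, c] concatenate to one of [a, c].  The two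
    suprema are taken one after the other, which requires the quantities moved
    across the inequality to be finite; this is the case unless the supremum
    over [a, c] is infinite. *)
Lemma control_partition_sup (R : realType) (F : R -> R -> \bar R) (s t : R) :
  (forall u v, (0 <= F u v)%E) -> control (partition_sup F) s t.
Proof.
move=> F0.
have ex_partition (a b : R) : a <= b -> exists l, itv_partition a b l.
  rewrite le_eqVlt => /predU1P[<-|/itv_partition1 ?]; last by exists [:: b].
  by exists [::]; split => /=.
have sum0 := partition_sum_ge0 _ _ F0.
split=> [a b _ /ex_partition[l lab] _|a b c _ ab bc _].
  by apply: le_trans (sum0 a l) (ereal_sup_ubound _); exists l.
set Z := partition_sup F a c.
have [Zfin|] := ltP Z +oo%E; last first.
  by rewrite leye_eq => /eqP ->; rewrite leey.
have cat_le l1 l2 : itv_partition a b l1 -> itv_partition b c l2 ->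
    (partition_sum F a l1 + partition_sum F b l2 <= Z)%E.
  move=> l1ab l2bc; apply: ereal_sup_ubound; exists (l1 ++ l2).
    exact: itv_partition_cat l2bc.
  by rewrite partition_sum_cat; case: l1ab => _ /eqP ->.
have [[l1 l1ab] [l2 l2bc]] := (ex_partition _ _ ab, ex_partition _ _ bc).
have supl_le l : itv_partition b c l ->
    (partition_sup F a b + partition_sum F b l <= Z)%E.
  move=> lbc; have fin : partition_sum F b l \is a fin_num.
    rewrite ge0_fin_numE ?sum0//; apply: le_lt_trans Zfin.
    by apply: le_trans (cat_le _ _ l1ab lbc); rewrite leeDr ?sum0.
  rewrite -leeBrDr//; apply: ge_ereal_sup => _ [l' l'ab <-].
  by rewrite leeBrDr// cat_le.
have sup0 : (0 <= partition_sup F a b)%E.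
  by apply: le_trans (sum0 a l1) (ereal_sup_ubound _); exists l1.
have fin : partition_sup F a b \is a fin_num.
  rewrite ge0_fin_numE//; apply: le_lt_trans Zfin.
  by apply: le_trans (supl_le _ l2bc); rewrite leeDl ?sum0.
rewrite addeC -leeBrDr//; apply: ge_ereal_sup => _ [l lbc <-].
by rewrite leeBrDr// addeC supl_le.
Qed.

Lemma controlled_partition_sup (R : realType) (E : metricType R) (delta p : R)
    (f : R -> E) (s t : R) :
  controlled p (delta * p - 1) f
    (partition_sup (fun u v =>
      (mdist (f u) (f v) `^ p / `|v - u| `^ (delta * p - 1))%:E)) s t.
Proof.
split.
  by apply: control_partition_sup => u v; rewrite lee_fin divr_ge0 ?powR_ge0.
move=> u v su uv vt.
set F := (X in partition_sup X).
apply: (@le_trans _ _ (((v - u) `^ (delta * p - 1))%:E * F u v)%E); last first.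
  by rewrite lee_wpmul2l ?lee_fin ?powR_ge0// le_partition_sup.
have vu : 0 < v - u by rewrite subr_gt0.
rewrite /F -EFinM lee_fin gtr0_norm// mulrC divfK//.
by rewrite gt_eqF// powR_gt0.
Qed.

(** * Finite seminorms for controlled paths *)

Lemma Vnorm_lty_of_controlled (R : realType) (E : metricType R) (delta p : R)
    (f : R -> E) (w : R -> R -> \bar R) (s t : R) :
  controlled p (delta * p - 1) f w s t -> (w s t < +oo)%E ->
  (Vnorm delta p f s t < +oo)%E.
Proof.
move=> [wc fw] wfin; apply: poweR_lty; apply: le_lt_trans wfin.
apply: partition_sup_le_control => // u v su uv vt.
have vu : 0 < v - u by rewrite subr_gt0.
have := fw _ _ su uv vt; rewrite muleC -lee_pdivrMr ?powR_gt0//.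
by rewrite -EFinM gtr0_norm.
Qed.

Lemma Nnorm_lty_of_controlled (R : realType) (E : metricType R) (delta p : R)
    (f : R -> E) (w : R -> R -> \bar R) (s t : R) : 0 < p -> continuous f ->
  s < t -> controlled p (delta * p - 1) f w s t -> (w s t < +oo)%E ->
  (Nnorm delta p f s t < +oo)%E.
Proof.
move=> p0 cf st fw; move/(le_lt_trans (Nnorm_le_control p0 cf st fw)).
by apply: lty_poweRy; rewrite gt_eqF.
Qed.

Lemma Nhatnorm_lty_of_controlled (R : realType) (E : metricType R) (delta p : R)
    (f : R -> E) (w : R -> R -> \bar R) (s t : R) : 0 < p -> continuous f ->
  controlled p (delta * p - 1) f w s t -> (w s t < +oo)%E ->
  (Nhatnorm delta p f s t < +oo)%E.
Proof.
move=> p0 cf fw wfin; apply: poweR_lty; apply: le_lt_trans wfin.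
apply: partition_sup_le_control; first exact: fw.1.
move=> u v su uv vt; apply: Nnorm_le_control => //.
exact: controlledS fw su vt.
Qed.

Lemma Nnorm_lty_of_Nhatnorm (R : realType) (E : metricType R) (delta p : R)
    (f : R -> E) (s t : R) : 0 < p -> s < t ->
  (Nhatnorm delta p f s t < +oo)%E -> (Nnorm delta p f s t < +oo)%E.
Proof.
move=> p0 st /lty_poweRy; rewrite invr_eq0 gt_eqF// => /(_ isT).
move/(le_lt_trans (le_partition_sup _ st)).
by apply: lty_poweRy; rewrite gt_eqF.
Qed.

(** * Reduction to paths continuous on the line *)

(** Composing with this retraction of the line onto [0, T] extends a path that
    is continuous on [0, T] to one that is continuous everywhere, with the same
    seminorms on [0, T]. *)
Definition clamp (R : realType) (T x : R) : R := Num.max 0 (Num.min x T).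

Lemma clamp_itv (R : realType) (T x : R) : 0 <= T -> clamp T x \in `[0, T].
Proof.
by move=> T0; rewrite in_itv/= le_max lexx/= ge_max T0 ge_min lexx orbT.
Qed.

Lemma clamp_id (R : realType) (T x : R) : x \in `[0, T] -> clamp T x = x.
Proof.
by rewrite in_itv/= => /andP[x0 xT]; rewrite /clamp (min_idPl xT) (max_idPr x0).
Qed.

Lemma continuous_clamp (R : realType) (T : R) : continuous (clamp T).
Proof.
move=> x; apply: (@continuous_max R R (cst 0) (fun x => Num.min x T)).
  exact: cvg_cst.
by apply: (@continuous_min R R id (cst T)); [exact: cvg_id|exact: cvg_cst].
Qed.

Lemma continuous_comp_clamp (R : realType) (E : metricType R) (T : R)
    (f : R -> E) : 0 <= T -> {within `[0, T], continuous f} ->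
  continuous (f \o clamp T).
Proof.
move=> T0 /subspace_continuousP cf x.
apply: (cvg_comp _ _ _ (cf (clamp T x) (clamp_itv x T0))).
move=> A clA.
have near_x : \forall y \near x, `[0, T]%classic (clamp T y) -> A (clamp T y).
  exact: (@continuous_clamp R T x _ clA).
change (\forall y \near x, A (clamp T y)).
by apply: filterS near_x => y; apply; exact: clamp_itv.
Qed.

Lemma eq_partition_sup (R : realType) (F G : R -> R -> \bar R) (s t : R) :
  (forall u v, s <= u -> u < v -> v <= t -> F u v = G u v) ->
  partition_sup F s t = partition_sup G s t.
Proof.
move=> FG; rewrite /partition_sup; congr ereal_sup.
apply: eq_imagel => l lst.
elim: l s FG lst => [|a l ih] s FG lst.
  by rewrite /partition_sum !big_nil.
have sa : s < a by case: lst => /= /andP[].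
have lat := itv_partition_cons lst; have a_le_t := itv_partition_le lat.
rewrite !partition_sum_cons FG//; congr (_ + _)%E; apply: ih => // u v au.
by apply: FG; apply: le_trans au; exact: ltW.
Qed.

Lemma eq_Nnorm (R : realType) (E : metricType R) (delta p : R) (f g : R -> E)
    (s t : R) : {in `[s, t], f =1 g} ->
  Nnorm delta p f s t = Nnorm delta p g s t.
Proof.
move=> fg; rewrite !NnormE; apply: congr1; apply: eq_imagel => h /=.
rewrite in_itv/= => /andP[h0 hts].
have -> // : increment_integral p f h s t = increment_integral p g h s t.
apply: eq_integral => u; rewrite inE/= in_itv/= => /andP[su ut].
have us : u \in `[s, t] by rewrite in_itv/=; apply/andP; split; lra.
have uhs : u + h \in `[s, t] by rewrite in_itv/=; apply/andP; split; lra.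
by rewrite (fg u us) (fg _ uhs).
Qed.

Lemma eq_Vnorm (R : realType) (E : metricType R) (delta p : R) (f g : R -> E)
    (s t : R) : {in `[s, t], f =1 g} ->
  Vnorm delta p f s t = Vnorm delta p g s t.
Proof.
move=> fg; rewrite /Vnorm; apply: (congr1 (fun x => x `^ p^-1)%E).
apply: eq_partition_sup => u v su uv vt.
have us : u \in `[s, t] by rewrite in_itv/=; apply/andP; split; lra.
have vs : v \in `[s, t] by rewrite in_itv/=; apply/andP; split; lra.
by rewrite (fg u us) (fg v vs).
Qed.

Lemma eq_Nhatnorm (R : realType) (E : metricType R) (delta p : R)
    (f g : R -> E) (s t : R) : {in `[s, t], f =1 g} ->
  Nhatnorm delta p f s t = Nhatnorm delta p g s t.
Proof.
move=> fg; rewrite /Nhatnorm; apply: (congr1 (fun x => x `^ p^-1)%E).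
apply: eq_partition_sup => u v su uv vt.
have -> // : Nnorm delta p f u v = Nnorm delta p g u v.
apply: eq_Nnorm => x; rewrite in_itv/= => /andP[ux xv].
by apply: fg; rewrite in_itv/=; apply/andP; split; lra.
Qed.

Lemma eq_Wnorm (R : realType) (E : metricType R) (delta p : R) (f g : R -> E)
    (s t : R) : {in `[s, t], f =1 g} ->
  Wnorm delta p f s t = Wnorm delta p g s t.
Proof.
move=> fg; rewrite /Wnorm; apply: (congr1 (fun x => x `^ p^-1)%E).
apply: eq_integral => -[u v]; rewrite inE/= => -[su sv].
by rewrite (fg u su) (fg v sv).
Qed.

(** * The inclusions *)

Theorem corollary2p12 (R : realType) (E : metricType R) (T delta p : R)
    (T_gt0 : 0 < T) (delta_gt0 : 0 < delta) (delta_lt1 : delta < 1)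
    (p_gt1 : 1 < p) (delta_gtVp : p^-1 < delta) :
  (Wspace E T delta p `<=` Vspace E T delta p /\
   Vspace E T delta p `<=` Nspace E T delta p) /\
  (forall eps : R, 0 < eps -> eps < 1 - delta ->
   Nspace E T (delta + eps) p `<=` Nhatspace E T delta p /\
   Nhatspace E T delta p `<=` Nspace E T delta p).
Proof.
have p_gt0 : 0 < p by exact: lt_trans p_gt1.
have T_ge0 := ltW T_gt0.
have clampE (f : R -> E) : {in `[0, T], f =1 f \o clamp T}.
  by move=> x xT /=; rewrite clamp_id.
have energy_lty (f : R -> E) tau : continuous f -> 0 < tau -> T <= 2 * tau ->
    (dyadic_energy p (delta * p) f tau 0%R T < +oo)%E ->
    exists2 w, controlled p (delta * p - 1) f w 0 T & (w 0%R T < +oo)%E.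
  move=> cf tau0 Ttau en.
  exists (fun a b => ((4 * (1 + (1 - 2 `^ (- (delta - p^-1)))^-1)) `^ p)%:E *
      (dyadic_energy p (delta * p) f tau a b + (b - a)%:E))%E.
    exact: controlled_dyadic_energy.
  rewrite lte_mul_pinfty ?lee_fin ?powR_ge0//.
  by rewrite lte_add_pinfty// ltry.
split; [split|move=> eps eps0 eps1; split] => f [cf];
  have cF := continuous_comp_clamp T_ge0 cf.
- rewrite (eq_Wnorm _ _ (clampE f)) => Wf; split=> //.
  have [tau /andP[tauT _] en] := dyadic_energy_lty_of_Wnorm cF p_gt0 T_gt0 Wf.
  have [| |w fw wfin] := energy_lty _ _ cF _ _ en; [lra..|].
  by rewrite (eq_Vnorm _ _ (clampE f)); exact: Vnorm_lty_of_controlled wfin.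
- rewrite (eq_Vnorm _ _ (clampE f)) => Vf; split=> //.
  rewrite (eq_Nnorm _ _ (clampE f)).
  apply: (Nnorm_lty_of_controlled p_gt0 cF T_gt0
    (controlled_partition_sup _ _ _ _ _)).
  by move/lty_poweRy: Vf; apply; rewrite invr_eq0 gt_eqF.
- rewrite (eq_Nnorm _ _ (clampE f)) => Nf; split=> //.
  have en := dyadic_energy_lty_of_Nnorm p_gt0 eps0 T_gt0 Nf.
  have [| |w fw wfin] := energy_lty _ _ cF _ _ en; [lra..|].
  rewrite (eq_Nhatnorm _ _ (clampE f)).
  exact: Nhatnorm_lty_of_controlled wfin.
- by move=> Nf; split=> //; exact: Nnorm_lty_of_Nhatnorm Nf.
Qed.
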